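(* Let $(M,\vec\xi,\eta,g,D)$ be a sub-Riemannian manifold of contact type, and let $N:TM\to TM$ be an endomorphism of the tangent bundle with $N\vec\xi=0$ and $N(D)\subset D$. Let $\nabla^N$ be the associated $N$-connection, with torsion $S(X,Y)=\nabla^N_XY-\nabla^N_YX-[X,Y]$. Then $\nabla^N$ is skew-symmetric, i.e. the tensor $\tilde S(X,Y,Z)=g(S(X,Y),Z)$ is totally skew-symmetric, if and only if $N=2\psi$.
   Context: A sub-Riemannian manifold of contact type $(M,\vec\xi,\eta,g,D)$ is a smooth manifold $M$ of odd dimension $n=2m+1$ with a Riemannian metric $g$, a unit vector field $\vec\xi$ and a 1-form $\eta$ with $\eta(X)=g(X,\vec\xi)$; $D=\ker\eta$, and $D^\perp=\mathrm{Span}(\vec\xi)$, so $TM=D\oplus D^\perp$. No nondegeneracy of $d\eta$ is assumed. The exterior derivative convention is $2d\eta(X,Y)=X\eta(Y)-Y\eta(X)-\eta([X,Y])$, and $\omega=d\eta$. The endomorphism $\psi:TM\to TM$ is transversal: $\psi\vec\xi=0$, $\psi(D)\subset D$ and $g(\psi X,Y)=\omega(X,Y)$ for $X,Y\in D$. The endomorphism $C:TM\to TM$ is transversal: $C\vec\xi=0$, $C(D)\subset D$ and $g(CX,Y)=\frac12(L_{\vec\xi}\,g)(X,Y)$ for $X,Y\in D$. Let $\widetilde\nabla$ be the Levi-Civita connection of $g$. The $N$-connection is $$\nabla^N_XY=\widetilde\nabla_XY+(\widetilde\nabla_X\eta)(Y)\,\vec\xi-\eta(Y)\widetilde\nabla_X\vec\xi-\eta(X)(\widetilde\nabla_{\vec\xi}\,\eta)(Y)\,\vec\xi-\eta(X)(C+\psi-N)Y.$$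 *)

(* Defs.v *)
From HB Require Import structures.
From mathcomp Require Import all_boot all_order all_algebra.
From mathcomp Require Import all_classical all_reals all_analysis.
From mathcomp Require Import ring.
Set Implicit Arguments.
Unset Strict Implicit.
Unset Printing Implicit Defensive.
Import Order.TTheory GRing.Theory Num.Theory.
Import numFieldNormedType.Exports.
Local Open Scope classical_set_scope.
Local Open Scope ring_scope.

(* [U] is meant to be open, and only the values of [f] on [U] matter
   ([Ck_on_ext]). *)
Fixpoint Ck_on (R : realType) (n k : nat) (U : set 'rV[R]_n)
    (f : 'rV[R]_n -> R) : Prop :=
  (forall x, U x -> {for x, continuous f}) /\
  if k is k'.+1 then
    forall i : 'I_n,
      (forall x, U x -> derivable f x (delta_mx 0 i)) /\
      Ck_on k' U ('D_(delta_mx 0 i) f)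
  else True.

Definition smooth_on (R : realType) (n : nat) (U : set 'rV[R]_n)
    (f : 'rV[R]_n -> R) : Prop :=
  forall k, Ck_on k U f.

Section Ck_theory.
Context {R : realType} {n : nat}.
Implicit Types (U : set 'rV[R]_n) (f g : 'rV[R]_n -> R).

Lemma Ck_onW k U f : Ck_on k.+1 U f -> Ck_on k U f.
Proof.
elim: k f => [|k IH] f [cf df]; split=> // i.
by have [d1 d2] := df i; split=> //; exact: IH.
Qed.

Lemma near_open_eq U f g x : open U -> {in U, f =1 g} -> U x ->
  {near x, f =1 g}.
Proof.
move=> oU fg Ux; apply: filterS (open_nbhs_nbhs (conj oU Ux)) => y Uy.
by apply: fg; rewrite inE.
Qed.

Lemma Ck_on_ext k U f g : open U -> {in U, f =1 g} ->
  Ck_on k U f -> Ck_on k U g.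
Proof.
move=> oU; elim: k f g => [|k IH] f g fg [cf df].
all: have nfg x : U x -> {near x, f =1 g} by exact: near_open_eq.
all: have cg x : U x -> {for x, continuous g}.
1,3: move=> Ux; rewrite /prop_for /continuous_at -(nbhs_singleton (nfg x Ux)).
1,2: exact: (cvg_trans (near_eq_cvg (nfg x Ux)) (cf x Ux)).
  by split.
split=> // i; have [d1 d2] := df i; split=> [x Ux|].
  by apply: near_eq_derivable (d1 x Ux); exact: nfg.
apply: (IH _ _ _ d2) => x; rewrite inE => Ux.
by rewrite (near_eq_derive _ (nfg x Ux)).
Qed.

Lemma Ck_on_cst k U (a : R) : open U -> Ck_on k U (cst a).
Proof.
move=> oU; elim: k a => [|k IH] a; split=> //.
1,2: by move=> x _; exact: cst_continuous.
move=> i; split=> [x _|]; first exact: derivable_cst.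
apply: (@Ck_on_ext k U (cst 0)) => // x _ /=.
exact/esym/derive_cst.
Qed.

Lemma Ck_on_add k U f g : open U -> Ck_on k U f -> Ck_on k U g ->
  Ck_on k U (f \+ g).
Proof.
move=> oU; elim: k f g => [|k IH] f g [cf df] [cg dg]; split=> //;
  try by move=> x Ux; apply: continuousD; [exact: cf|exact: cg].
move=> i; have [f1 f2] := df i; have [g1 g2] := dg i; split=> [x Ux|].
  by apply: derivableD; [exact: f1|exact: g1].
apply: Ck_on_ext (IH _ _ f2 g2) => // x; rewrite inE => Ux /=.
by rewrite deriveD//; [exact: f1|exact: g1].
Qed.

Lemma Ck_on_mul k U f g : open U -> Ck_on k U f -> Ck_on k U g ->
  Ck_on k U (f \* g).
Proof.
move=> oU; elim: k f g => [|k IH] f g /[dup] Hf [cf df] /[dup] Hg [cg dg];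
  split=> //; try by move=> x Ux; apply: continuousM; [exact: cf|exact: cg].
move=> i; have [f1 f2] := df i; have [g1 g2] := dg i; split=> [x Ux|].
  by apply: derivableM; [exact: f1|exact: g1].
apply: Ck_on_ext (Ck_on_add oU (IH _ _ (Ck_onW Hf) g2)
  (IH _ _ (Ck_onW Hg) f2)) => // x; rewrite inE => Ux /=.
by rewrite deriveM//; [exact: f1|exact: g1].
Qed.

End Ck_theory.

(* [chart_inv] matters only on the image of [chart_dom] under [chart_map]. *)
Record chart (R : realType) (n : nat) (M : Type) := Chart {
  chart_dom : set M;
  chart_map : M -> 'rV[R]_n;
  chart_inv : 'rV[R]_n -> M }.

Definition is_chart (R : realType) (n : nat) (M : topologicalType)
    (c : chart R n M) : Prop :=
  [/\ open (chart_dom c),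
      open (chart_map c @` chart_dom c),
      (forall p, chart_dom c p -> chart_inv c (chart_map c p) = p),
      (forall p, chart_dom c p -> {for p, continuous (chart_map c)}) &
      (forall x, (chart_map c @` chart_dom c) x ->
         {for x, continuous (chart_inv c)})].

Definition compatible (R : realType) (n : nat) (M : Type)
    (c c' : chart R n M) : Prop :=
  forall i : 'I_n, smooth_on (chart_map c @` (chart_dom c `&` chart_dom c'))
                             (fun x => chart_map c' (chart_inv c x) 0 i).

Record smooth_manifold (R : realType) (n : nat) := SmoothManifold {
  points :> topologicalType;
  manifold_hausdorff : hausdorff_space points;
  manifold_second_countable : @second_countable points;
  atlas : set (chart R n points);
  atlas_chart : forall c, atlas c -> is_chart c;
  atlas_cover : forall p : points, exists2 c, atlas c & chart_dom c p;
  atlas_compatible : forall c c', atlas c -> atlas c' -> compatible c c' }.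

Section smooth_functions.
Context {R : realType} {n : nat} (M : smooth_manifold R n).

Definition is_smooth (f : M -> R) : Prop :=
  forall c, atlas c ->
    smooth_on (chart_map c @` chart_dom c) (f \o chart_inv c).

Definition smooth_pred : {pred M -> R} := fun f => `[< is_smooth f >].

Lemma open_image (c : chart R n M) : atlas c ->
  open (chart_map c @` chart_dom c).
Proof. by move=> /atlas_chart[]. Qed.

Lemma is_smooth_cst (a : R) : is_smooth (cst a).
Proof. by move=> c Ac k; exact: (Ck_on_cst k a (open_image Ac)). Qed.

Lemma is_smoothD f g : is_smooth f -> is_smooth g -> is_smooth (f \+ g).
Proof.
move=> sf sg c Ac k.
exact: (Ck_on_add (open_image Ac) (sf c Ac k) (sg c Ac k)).
Qed.

Lemma is_smoothM f g : is_smooth f -> is_smooth g -> is_smooth (f \* g).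
Proof.
move=> sf sg c Ac k.
exact: (Ck_on_mul (open_image Ac) (sf c Ac k) (sg c Ac k)).
Qed.

Lemma smooth_subring : subring_closed smooth_pred.
Proof.
have sN f : is_smooth f -> is_smooth (- f).
  move=> sf; suff -> : - f = cst (-1) \* f.
    by apply: is_smoothM => //; exact: is_smooth_cst.
  by apply/funext => x /=; rewrite mulN1r.
split=> [|f g /asboolP sf /asboolP sg|f g /asboolP sf /asboolP sg];
  apply/asboolP.
- exact: is_smooth_cst.
- by apply: is_smoothD => //; exact: sN.
- exact: is_smoothM.
Qed.

End smooth_functions.

Record smooth_fun (R : realType) (n : nat) (M : smooth_manifold R n) :=
  SmoothFun { smf :> M -> R; smf_smooth : smf \in @smooth_pred R n M }.

Section smooth_fun_algebra.
Context {R : realType} {n : nat} {M : smooth_manifold R n}.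
Implicit Types f g : smooth_fun M.

HB.instance Definition _ := [isSub for (@smf R n M)].
HB.instance Definition _ := [Choice of smooth_fun M by <:].
HB.instance Definition _ := GRing.SubChoice_isSubComPzRing.Build
  (M -> R) (@smooth_pred R n M) (smooth_fun M) (@smooth_subring R n M).

Lemma smf_ext f g : (forall p, f p = g p) -> f = g.
Proof. by move=> fg; apply/val_inj/funext. Qed.

Lemma smfD f g p : (f + g) p = f p + g p.
Proof. by []. Qed.

Lemma smfN f p : (- f) p = - f p.
Proof. by []. Qed.

Lemma smfM f g p : (f * g) p = f p * g p.
Proof. by []. Qed.

Lemma smf0 p : (0 : smooth_fun M) p = 0.
Proof. by []. Qed.

Lemma smf1 p : (1 : smooth_fun M) p = 1.
Proof. by []. Qed.

Definition to_smf (f : M -> R) (sf : is_smooth f) : smooth_fun M :=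
  SmoothFun (asboolT sf : f \in @smooth_pred R n M).

Lemma smfP f : is_smooth f.
Proof. by have /asboolP := smf_smooth f. Qed.

Definition smf_scale (a : R) f : smooth_fun M :=
  to_smf (is_smoothM (@is_smooth_cst _ _ M a) (smfP f)).

Let scaleA a b f : smf_scale a (smf_scale b f) = smf_scale (a * b) f.
Proof. by apply: smf_ext => p; exact: mulrA. Qed.

Let scale1 : left_id 1 smf_scale.
Proof. by move=> f; apply: smf_ext => p; exact: mul1r. Qed.

Let scaleDr : right_distributive smf_scale +%R.
Proof. by move=> a f g; apply: smf_ext => p; exact: mulrDr. Qed.

Let scaleDl f : {morph smf_scale^~ f : a b / a + b}.
Proof. by move=> a b; apply: smf_ext => p; exact: mulrDl. Qed.

HB.instance Definition _ := GRing.Zmodule_isLmodule.Build R (smooth_fun M)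
  scaleA scale1 scaleDr scaleDl.

Lemma smfZ (a : R) f p : (a *: f) p = a * f p.
Proof. by []. Qed.

End smooth_fun_algebra.

Section tangent_vectors.
Context {R : realType} {n : nat} (M : smooth_manifold R n).

Definition derivation_at (p : M) (v : smooth_fun M -> R) : Prop :=
  (forall (a : R) f g, v (a *: f + g) = a * v f + v g) /\
  (forall f g, v (f * g) = f p * v g + g p * v f).

Record tangent (p : M) := Tangent {
  tan_fun :> smooth_fun M -> R;
  tan_derivation : derivation_at p tan_fun }.

Variable p : M.
Implicit Types v w : tangent p.

Lemma tan_ext v w : (forall f, v f = w f) -> v = w.
Proof.
case: v w => v dv [w dw] /= vw; have {}vw : v = w by exact/funext.
by case: w / vw dw => dw; congr Tangent; exact: Prop_irrelevance.
Qed.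

Let zero_der : derivation_at p (fun=> 0).
Proof. by split=> [a f g|f g]; rewrite !mulr0 addr0. Qed.
Let opp_der v : derivation_at p (fun f => - v f).
Proof.
case: v => v [vl vm] /=; split=> *; rewrite ?vl ?vm opprD ?mulrN//.
Qed.
Let add_der v w : derivation_at p (fun f => v f + w f).
Proof.
case: v w => v [vl vm] [w [wl wm]] /=.
by split=> *; rewrite ?vl ?vm ?wl ?wm addrACA !mulrDr.
Qed.
Let scale_der (a : R) v : derivation_at p (fun f => a * v f).
Proof.
case: v => v [vl vm] /=.
by split=> *; rewrite ?vl ?vm mulrDr; congr (_ + _); rewrite mulrCA.
Qed.

Definition tan_zero := Tangent zero_der.
Definition tan_opp v := Tangent (opp_der v).
Definition tan_add v w := Tangent (add_der v w).
Definition tan_scale (a : R) v := Tangent (scale_der a v).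

Let addA : associative tan_add.
Proof. by move=> u v w; apply: tan_ext => f; exact: addrA. Qed.
Let addC : commutative tan_add.
Proof. by move=> v w; apply: tan_ext => f; exact: addrC. Qed.
Let add0 : left_id tan_zero tan_add.
Proof. by move=> v; apply: tan_ext => f; exact: add0r. Qed.
Let addN : left_inverse tan_zero tan_opp tan_add.
Proof. by move=> v; apply: tan_ext => f; exact: addNr. Qed.

HB.instance Definition _ := gen_eqMixin (tangent p).
HB.instance Definition _ := gen_choiceMixin (tangent p).
HB.instance Definition _ := GRing.isZmodule.Build (tangent p)
  addA addC add0 addN.

Let scaleA a b v : tan_scale a (tan_scale b v) = tan_scale (a * b) v.
Proof. by apply: tan_ext => f; exact: mulrA. Qed.
Let scale1 : left_id 1 tan_scale.
Proof. by move=> v; apply: tan_ext => f; exact: mul1r. Qed.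
Let scaleDr : right_distributive tan_scale +%R.
Proof. by move=> a v w; apply: tan_ext => f; exact: mulrDr. Qed.
Let scaleDl v : {morph tan_scale^~ v : a b / a + b}.
Proof. by move=> a b; apply: tan_ext => f; exact: mulrDl. Qed.

HB.instance Definition _ := GRing.Zmodule_isLmodule.Build R (tangent p)
  scaleA scale1 scaleDr scaleDl.

End tangent_vectors.

(* A section [X] of the tangent bundle is smooth iff [p |-> X_p f] is smooth
   for every smooth function [f]. *)
Record vfield (R : realType) (n : nat) (M : smooth_manifold R n) := VField {
  vf_at : forall p : M, tangent p;
  vf_smooth : forall f : smooth_fun M, is_smooth (fun p => vf_at p f) }.

Section vector_fields.
Context {R : realType} {n : nat} {M : smooth_manifold R n}.
Implicit Types (X Y : vfield M) (f g : smooth_fun M).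

Definition vf_app X f : smooth_fun M := to_smf (vf_smooth X f).
Coercion vf_app : vfield >-> Funclass.

Lemma vf_appE X f p : X f p = vf_at X p f.
Proof. by []. Qed.

Lemma vf_ext X Y : (forall f p, X f p = Y f p) -> X = Y.
Proof.
case: X Y => X sX [Y sY] XY; have {}XY : X = Y.
  by apply/functional_extensionality_dep => p; apply: tan_ext => f; exact: XY.
by case: Y / XY sY => sY; congr VField; exact: Prop_irrelevance.
Qed.

Lemma vf_appD X f g : X (f + g) = X f + X g.
Proof.
apply: smf_ext => p; have [XD _] := tan_derivation (vf_at X p).
by have := XD 1 f g; rewrite scale1r mul1r.
Qed.

Lemma vf_appZ X (a : R) f : X (a *: f) = a *: X f.
Proof.
apply: smf_ext => p; have [XD _] := tan_derivation (vf_at X p).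
have X0 : vf_at X p 0 = 0.
  by have /eqP := XD 1 0 0; rewrite scale1r mul1r addr0 -subr_eq subrr => /eqP.
by have := XD a f 0; rewrite X0 !addr0.
Qed.

Lemma vf_appM X f g : X (f * g) = f * X g + g * X f.
Proof.
by apply: smf_ext => p; have [_] := tan_derivation (vf_at X p); apply.
Qed.

Let zero_smooth f : is_smooth (fun p => (0 : tangent p) f).
Proof. exact: is_smooth_cst. Qed.
Let opp_smooth X f : is_smooth (fun p => (- vf_at X p) f).
Proof. exact: smfP (- X f). Qed.
Let add_smooth X Y f : is_smooth (fun p => (vf_at X p + vf_at Y p) f).
Proof. exact: smfP (X f + Y f). Qed.
Let scale_smooth g X f : is_smooth (fun p => (g p *: vf_at X p) f).
Proof. exact: smfP (g * X f). Qed.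

Definition vf_zero : vfield M := VField zero_smooth.
Definition vf_opp X := VField (opp_smooth X).
Definition vf_add X Y := VField (add_smooth X Y).
Definition vf_scale g X := VField (scale_smooth g X).

Let addA : associative vf_add.
Proof. by move=> X Y Z; apply: vf_ext => f p; exact: addrA. Qed.
Let addC : commutative vf_add.
Proof. by move=> X Y; apply: vf_ext => f p; exact: addrC. Qed.
Let add0 : left_id vf_zero vf_add.
Proof. by move=> X; apply: vf_ext => f p; exact: add0r. Qed.
Let addN : left_inverse vf_zero vf_opp vf_add.
Proof. by move=> X; apply: vf_ext => f p; exact: addNr. Qed.

HB.instance Definition _ := gen_eqMixin (vfield M).
HB.instance Definition _ := gen_choiceMixin (vfield M).
HB.instance Definition _ := GRing.isZmodule.Build (vfield M)
  addA addC add0 addN.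

Let scaleA f g X : vf_scale f (vf_scale g X) = vf_scale (f * g) X.
Proof. by apply: vf_ext => h p; exact: mulrA. Qed.
Let scale1 : left_id 1 vf_scale.
Proof. by move=> X; apply: vf_ext => f p; exact: mul1r. Qed.
Let scaleDr : right_distributive vf_scale +%R.
Proof. by move=> g X Y; apply: vf_ext => f p; exact: mulrDr. Qed.
Let scaleDl X : {morph vf_scale^~ X : f g / f + g}.
Proof. by move=> f g; apply: vf_ext => h p; exact: mulrDl. Qed.

HB.instance Definition _ := GRing.Zmodule_isLmodule.Build
  (smooth_fun M) (vfield M) scaleA scale1 scaleDr scaleDl.

Lemma vf_addE X Y f : (X + Y) f = X f + Y f.
Proof. exact: smf_ext. Qed.

Lemma vf_oppE X f : (- X) f = - X f.
Proof. exact: smf_ext. Qed.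

Lemma vf_scaleE g X f : (g *: X) f = g * X f.
Proof. exact: smf_ext. Qed.

Let lie_der X Y p : derivation_at p (fun f => (X (Y f) - Y (X f)) p).
Proof.
split=> [a f g|f g].
  rewrite !(vf_appD, vf_appZ) !(smfD, smfN, smfZ); ring.
rewrite !(vf_appM, vf_appD) !(smfD, smfN, smfM); ring.
Qed.

Definition lie_bracket X Y : vfield M :=
  @VField R n M (fun p => Tangent (lie_der X Y p))
    (fun f => smfP (X (Y f) - Y (X f))).

Lemma lie_bracketE X Y f : lie_bracket X Y f = X (Y f) - Y (X f).
Proof. exact: smf_ext. Qed.

End vector_fields.

(* Tensor fields are maps on vector fields that are multilinear over smooth
   functions: a 1-form is a [{scalar vfield M}], an endomorphism of the tangent
   bundle is a [{linear vfield M -> vfield M}]. *)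

Record riemannian_metric (R : realType) (n : nat) (M : smooth_manifold R n) :=
  RiemannianMetric {
  metric :> vfield M -> vfield M -> smooth_fun M;
  metric_linear : forall (f : smooth_fun M) X Y Z,
    metric (f *: X + Y) Z = f * metric X Z + metric Y Z;
  metric_sym : forall X Y, metric X Y = metric Y X;
  metric_pos : forall X p, vf_at X p != 0 -> 0 < metric X X p }.

Record affine_connection (R : realType) (n : nat) (M : smooth_manifold R n) :=
  AffineConnection {
  nabla :> vfield M -> vfield M -> vfield M;
  nabla_linear : forall (f : smooth_fun M) X Y Z,
    nabla (f *: X + Y) Z = f *: nabla X Z + nabla Y Z;
  nablaD : forall X Y Z, nabla X (Y + Z) = nabla X Y + nabla X Z;
  nabla_leibniz : forall X (f : smooth_fun M) Y,
    nabla X (f *: Y) = X f *: Y + f *: nabla X Y }.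

Section geometry.
Context {R : realType} {n : nat} {M : smooth_manifold R n}.
Implicit Types (X Y Z : vfield M) (g : riemannian_metric M)
  (eta : {scalar vfield M}).

Definition torsion (D : vfield M -> vfield M -> vfield M) X Y : vfield M :=
  D X Y - D Y X - lie_bracket X Y.

Definition is_levi_civita g (D : affine_connection M) : Prop :=
  (forall X Y Z, X (g Y Z) = g (D X Y) Z + g Y (D X Z)) /\
  (forall X Y, torsion D X Y = 0).

Definition totally_skew (T : vfield M -> vfield M -> vfield M -> smooth_fun M)
    : Prop :=
  [/\ forall X Y Z, T Y X Z = - T X Y Z,
      forall X Y Z, T X Z Y = - T X Y Z &
      forall X Y Z, T Z Y X = - T X Y Z].

Definition skew_connection g (D : vfield M -> vfield M -> vfield M) : Prop :=
  totally_skew (fun X Y Z => g (torsion D X Y) Z).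

(* Convention: 2 d eta (X, Y) = X eta(Y) - Y eta(X) - eta([X, Y]). *)
Definition ext_deriv eta X Y : smooth_fun M :=
  (2^-1 : R) *: (X (eta Y) - Y (eta X) - eta (lie_bracket X Y)).

Definition cov_deriv_form (D : affine_connection M) X eta Y : smooth_fun M :=
  X (eta Y) - eta (D X Y).

Definition lie_deriv_metric Z g X Y : smooth_fun M :=
  Z (g X Y) - g (lie_bracket Z X) Y - g X (lie_bracket Z Y).

End geometry.

(* The distribution is not a field: it is the kernel of [ct_eta], and [ct_D]
   below is its module of sections. *)
Record contact_type (R : realType) (n : nat) (M : smooth_manifold R n) :=
  ContactType {
  ct_xi : vfield M;
  ct_eta : {scalar vfield M};
  ct_g : riemannian_metric M;
  ct_unit : ct_g ct_xi ct_xi = 1;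
  ct_eta_dual : forall X, ct_eta X = ct_g X ct_xi }.

Section contact_geometry.
Context {R : realType} {n : nat} {M : smooth_manifold R n}.
Variable S : contact_type M.
Local Notation xi := (ct_xi S).
Local Notation eta := (ct_eta S).
Local Notation g := (ct_g S).

Definition ct_D : set (vfield M) := [set X | eta X = 0].

Definition transversal_endo (F : {linear vfield M -> vfield M}) : Prop :=
  F xi = 0 /\ forall X, ct_D X -> ct_D (F X).

Definition is_psi (psi : {linear vfield M -> vfield M}) : Prop :=
  transversal_endo psi /\
  forall X Y, ct_D X -> ct_D Y -> g (psi X) Y = ext_deriv eta X Y.

Definition is_C (C : {linear vfield M -> vfield M}) : Prop :=
  transversal_endo C /\
  forall X Y, ct_D X -> ct_D Y ->
    g (C X) Y = (2^-1 : R) *: lie_deriv_metric xi g X Y.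

Definition N_connection (D : affine_connection M)
    (C psi N : {linear vfield M -> vfield M}) (X Y : vfield M) : vfield M :=
  D X Y + cov_deriv_form D X eta Y *: xi - eta Y *: D X xi
    - (eta X * cov_deriv_form D xi eta Y) *: xi
    - eta X *: (C Y + psi Y - N Y).

End contact_geometry.

(* Main.v *)
Require Import Defs.
From HB Require Import structures.
From mathcomp Require Import all_boot all_order all_algebra.
From mathcomp Require Import all_classical all_reals all_analysis.
From mathcomp Require Import ring.
Set Implicit Arguments.
Unset Strict Implicit.
Unset Printing Implicit Defensive.
Import Order.TTheory GRing.Theory Num.Theory.
Import numFieldNormedType.Exports.
Local Open Scope ring_scope.

(** Everything rests on one formula for the torsion of the N-connection,
    [S(X,Y) = 2 g(psi X, Y) xi + eta(X) N Y - eta(Y) N X]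
    ([torsion_N_connection]).  To obtain it, note that the Levi-Civita
    derivative of [xi] is the sum of its symmetric and skew parts on the
    distribution: there [g(nabla_X xi, Y) + g(X, nabla_Y xi)] is the Lie
    derivative of the metric, which defines [C], and
    [g(nabla_X xi, Y) - g(X, nabla_Y xi)] is [2 d eta(X, Y)], which defines
    [psi].  Since [xi] has unit length, [nabla_X xi] is horizontal, so that
    [nabla_X xi = C X + psi X + eta(X) nabla_xi xi] for every [X]
    ([nabla_xiE]).  In the torsion of the N-connection the Levi-Civita torsion
    vanishes, the terms in [nabla_xi xi] and [C + psi] cancel, and [C]
    disappears from the coefficient of [xi] because it is symmetric.

    If [N = 2 psi], the torsion tensor is twice the cyclic sum of
    [g(psi X, Y) eta(Z)], which is totally skew because [psi] is.  Conversely,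
    skew symmetry in the last two arguments, evaluated on [X], [xi], [Z], reads
    [- g(N X, Z) = - 2 g(psi X, Z)] because [N] and [psi] are transversal, and
    the metric is nondegenerate. *)

(** * Bilinearity and nondegeneracy of the metric *)

Section metric_theory.
Context {R : realType} {n : nat} {M : smooth_manifold R n}.
Variable g : riemannian_metric M.
Implicit Types (X Y Z : vfield M) (f : smooth_fun M).

Lemma metricDl X Y Z : g (X + Y) Z = g X Z + g Y Z.
Proof. by rewrite -[X]scale1r metric_linear mul1r scale1r. Qed.

Lemma metric0l Z : g 0 Z = 0.
Proof. by apply: (addrI (g 0 Z)); rewrite -metricDl !addr0. Qed.

Lemma metricZl f X Z : g (f *: X) Z = f * g X Z.
Proof. by rewrite -[f *: X]addr0 metric_linear metric0l addr0. Qed.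

Lemma metricNl X Z : g (- X) Z = - g X Z.
Proof. by rewrite -scaleN1r metricZl mulN1r. Qed.

Lemma metricDr X Y Z : g X (Y + Z) = g X Y + g X Z.
Proof. by rewrite Defs.metric_sym metricDl !(Defs.metric_sym _ X). Qed.

Lemma metricNr X Y : g X (- Y) = - g X Y.
Proof. by rewrite Defs.metric_sym metricNl Defs.metric_sym. Qed.

Lemma metricZr f X Y : g X (f *: Y) = f * g X Y.
Proof. by rewrite Defs.metric_sym metricZl Defs.metric_sym. Qed.

Lemma metric_definite X : g X X = 0 -> X = 0.
Proof.
move=> gX0; apply: vf_ext => f p.
have [Xp0|/(metric_pos g)] := eqVneq (vf_at X p) 0.
  by rewrite !vf_appE Xp0.
by rewrite gX0 ltxx.
Qed.

Lemma metric_inj X Y : (forall Z, g X Z = g Y Z) -> X = Y.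
Proof.
move=> XY; apply/eqP; rewrite -subr_eq0; apply/eqP/metric_definite.
by rewrite metricDl metricNl XY subrr.
Qed.

End metric_theory.

Lemma smf_halves (R : realType) (n : nat) (M : smooth_manifold R n)
    (f : smooth_fun M) : (2^-1 : R) *: (f + f) = f.
Proof. by rewrite scalerDr -scalerDl -[2^-1]mul1r -splitr scale1r. Qed.

(** * Transversal endomorphisms *)

Section transversal_theory.
Context {R : realType} {n : nat} {M : smooth_manifold R n}.
Variable CT : contact_type M.
Local Notation xi := (ct_xi CT).
Local Notation eta := (ct_eta CT).
Local Notation g := (ct_g CT).
Implicit Types (X Y Z : vfield M) (F : {linear vfield M -> vfield M}).

Definition horizontal X : vfield M := X - eta X *: xi.

Lemma eta_xi : eta xi = 1.
Proof. by rewrite ct_eta_dual ct_unit. Qed.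

Lemma horizontal_D X : ct_D CT (horizontal X).
Proof.
by rewrite /ct_D /= /horizontal linearB linearZ /= eta_xi mulr1 subrr.
Qed.

Lemma horizontalE X : X = horizontal X + eta X *: xi.
Proof. by rewrite subrK. Qed.

Lemma transversal_horizontal F X : transversal_endo CT F ->
  F (horizontal X) = F X.
Proof. by case=> Fxi _; rewrite linearB linearZ /= Fxi scaler0 subr0. Qed.

Lemma eta_transversal F X : transversal_endo CT F -> eta (F X) = 0.
Proof.
move=> tF; rewrite -(transversal_horizontal X tF).
by case: tF => _; apply; exact: horizontal_D.
Qed.

Lemma metric_horizontal X Y : eta X = 0 -> g X (horizontal Y) = g X Y.
Proof.
move=> X0; rewrite metricDr metricNr metricZr -ct_eta_dual X0.
by rewrite mulr0 subr0.
Qed.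

Lemma transversal_metric F X Y : transversal_endo CT F ->
  g (F (horizontal X)) (horizontal Y) = g (F X) Y.
Proof.
by move=> tF; rewrite transversal_horizontal// metric_horizontal//
  eta_transversal.
Qed.

Lemma ext_deriv_skew X Y : ext_deriv eta Y X = - ext_deriv eta X Y.
Proof.
rewrite /ext_deriv -scalerN; congr (_ *: _).
have -> : lie_bracket Y X = - lie_bracket X Y.
  by apply: vf_ext => f p; rewrite vf_oppE !lie_bracketE opprB.
by rewrite linearN; ring.
Qed.

(** The defining equation of [psi] holds only on the distribution; it
    determines [g(psi X, Y)] for all fields because [psi] is transversal.  The
    same applies to [C] below. *)
Lemma psi_skew (psi : {linear vfield M -> vfield M}) X Y :
  is_psi CT psi -> g (psi Y) X = - g (psi X) Y.
Proof.
case=> tpsi psiE; rewrite -(transversal_metric Y X tpsi).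
rewrite -(transversal_metric X Y tpsi) !psiE; try exact: horizontal_D.
exact: ext_deriv_skew.
Qed.

Lemma C_sym (C : {linear vfield M -> vfield M}) X Y :
  is_C CT C -> g (C Y) X = g (C X) Y.
Proof.
case=> tC CE; rewrite -(transversal_metric Y X tC).
rewrite -(transversal_metric X Y tC) !CE; try exact: horizontal_D.
congr (_ *: _); rewrite /lie_deriv_metric (Defs.metric_sym g (horizontal Y)).
by rewrite addrAC ![g (lie_bracket _ _) _]Defs.metric_sym.
Qed.

End transversal_theory.

(** * The Levi-Civita derivative of the unit field xi *)

Section levi_civita_xi.
Context {R : realType} {n : nat} {M : smooth_manifold R n}.
Variables (CT : contact_type M) (LC : affine_connection M).
Variables psi C : {linear vfield M -> vfield M}.
Local Notation xi := (ct_xi CT).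
Local Notation eta := (ct_eta CT).
Local Notation g := (ct_g CT).
Hypotheses (LCg : is_levi_civita g LC) (psiP : is_psi CT psi) (CP : is_C CT C).
Implicit Types X Y Z : vfield M.

Lemma levi_civita_bracket X Y : lie_bracket X Y = LC X Y - LC Y X.
Proof. by case: LCg => _ /(_ X Y)/eqP; rewrite subr_eq0 => /eqP. Qed.

(** Parallelism of the metric, applied to [eta(Y) = g(Y, xi)]. *)
Lemma cov_deriv_eta X Y : cov_deriv_form LC X eta Y = g (LC X xi) Y.
Proof.
case: LCg => /(_ X Y xi) gP _.
by rewrite /cov_deriv_form !ct_eta_dual gP addrAC subrr add0r Defs.metric_sym.
Qed.

(** Half the derivative along [X] of the constant [g(xi, xi) = 1]. *)
Lemma eta_nabla_xi X : eta (LC X xi) = 0.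
Proof.
case: LCg => /(_ X xi xi) gP _.
rewrite ct_eta_dual -[LHS]smf_halves.
rewrite {2}Defs.metric_sym -gP ct_unit.
(* derivations kill the constant 1 *)
have : X (1 * 1) = X 1 by rewrite mulr1.
by rewrite vf_appM !mul1r => /(canRL (addrK _)); rewrite subrr => ->;
  rewrite scaler0.
Qed.

Lemma ext_deriv_nabla X Y :
  ext_deriv eta X Y = (2^-1 : R) *: (g (LC X xi) Y - g (LC Y xi) X).
Proof.
rewrite /ext_deriv -!cov_deriv_eta /cov_deriv_form levi_civita_bracket.
by congr (_ *: _); rewrite linearB /=; ring.
Qed.

Lemma lie_deriv_metric_nabla X Y :
  lie_deriv_metric xi g X Y = g (LC X xi) Y + g (LC Y xi) X.
Proof.
case: LCg => /(_ xi X Y) gP _.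
rewrite /lie_deriv_metric gP !levi_civita_bracket.
rewrite metricDl metricNl metricDr metricNr (Defs.metric_sym g (LC Y xi)); ring.
Qed.

(** On the distribution, [psi] is the skew part and [C] the symmetric part of
    the derivative of [xi]; the last term accounts for the vertical
    component of [X]. *)
Lemma nabla_xiE X : LC X xi = C X + psi X + eta X *: LC xi xi.
Proof.
have [[tpsi psiE] [tC CE]] := (psiP, CP).
have LCh : LC X xi = LC (horizontal CT X) xi + eta X *: LC xi xi.
  by rewrite {1}(horizontalE CT X) addrC nabla_linear addrC.
rewrite LCh; congr (_ + _); apply: (@metric_inj _ _ _ g) => Z.
have hD := @horizontal_D _ _ _ CT.
rewrite -(metric_horizontal _ (eta_nabla_xi _)) metricDl.
rewrite -(transversal_metric X Z tC) -(transversal_metric X Z tpsi).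
rewrite CE ?psiE; try exact: hD.
rewrite ext_deriv_nabla lie_deriv_metric_nabla -scalerDr.
by rewrite addrACA subrr addr0 smf_halves.
Qed.

(** Substituting the formula for [nabla_X xi] makes the terms in [nabla_xi xi]
    and the terms [eta(X) (C + psi) Y] cancel.  What is left of [C] and [psi]
    is the coefficient [g((C + psi) X, Y) - g((C + psi) Y, X)] of [xi], and
    symmetry of [C] with skew symmetry of [psi] reduces it to
    [2 g(psi X, Y)]. *)
Lemma torsion_N_connection (N : {linear vfield M -> vfield M}) X Y Z :
  g (torsion (N_connection CT LC C psi N) X Y) Z =
  (g (psi X) Y + g (psi X) Y) * eta Z + eta X * g (N Y) Z - eta Y * g (N X) Z.
Proof.
rewrite /torsion levi_civita_bracket /N_connection !cov_deriv_eta.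
rewrite (nabla_xiE X) (nabla_xiE Y) (ct_eta_dual CT Z).
rewrite !(metricDl, metricNl, metricZl) (psi_skew X Y psiP) (C_sym X Y CP).
rewrite (Defs.metric_sym g Z); ring.
Qed.

End levi_civita_xi.

Theorem proposition2 (R : realType) (m : nat)
    (M : smooth_manifold R (2 * m + 1)%N) (CT : contact_type M)
    (LC : affine_connection M) (psi C N : {linear vfield M -> vfield M}) :
  is_levi_civita (ct_g CT) LC ->
  is_psi CT psi ->
  is_C CT C ->
  transversal_endo CT N ->
  skew_connection (ct_g CT) (N_connection CT LC C psi N) <->
  (forall X, N X = 2 *: psi X).
Proof.
move=> LCg psiP CP tN; have tpsi := psiP.1.
have TE := torsion_N_connection LCg psiP CP N.
split=> [[_ skew23 _] X|NE].
  apply: (@metric_inj _ _ _ (ct_g CT)) => Z.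
  (* the slot filled by [xi] isolates [N] on one side and [psi] on the other *)
  have := skew23 X Z (ct_xi CT).
  rewrite !TE eta_xi -!(ct_eta_dual CT) !eta_transversal// tN.1.
  rewrite metric0l metricZl.
  rewrite !(addr0, mulr0, mul0r, add0r, oppr0, mul1r, mulr1, subr0).
  by move/oppr_inj => ->; rewrite mulr_natl mulr2n.
have psiS X Y := psi_skew X Y psiP.
split=> X Y Z; rewrite !TE !NE !metricZl.
- by rewrite (psiS X Y); ring.
- by rewrite (psiS Y Z); ring.
- by rewrite (psiS Y Z) (psiS X Z) (psiS X Y); ring.
Qed.
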